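(* Let $b=b(n)=o(\sqrt n)$. Then for all sufficiently large $n$, in the $(1:b)$ Maker-Breaker game played on $E(K_n)$, Maker has a winning strategy in the pancyclicity game.
   Context: In a $(1:b)$ Maker-Breaker game on the board $E(K_n)$, Maker and Breaker alternately claim previously unclaimed edges of $K_n$, Maker one edge per turn and Breaker $b$ edges per turn. In the pancyclicity game, Maker wins if at the end the graph formed by his edges is pancyclic, i.e. contains a cycle of every length $\ell$ with $3\le \ell\le n$; otherwise Breaker wins. *)

(* Defs.v *)
From mathcomp Require Import all_boot.

Set Implicit Arguments.
Unset Strict Implicit.
Unset Printing Implicit Defensive.

Variant player := Maker | Breaker.

Definition opponent (p : player) : player :=
  if p is Maker then Breaker else Maker.

Section MakerBreaker.
Variables (T : finType) (X : {set T}) (b : nat) (first : player).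

(* A history lists the sets claimed in the successive turns, oldest first;
   the turns alternate between the players, starting with [first]. *)
Implicit Types (h : seq {set T}) (A : {set T}).

Definition to_move h : player := iter (size h) opponent first.

Definition unclaimed h : {set T} := X :\: \bigcup_(A <- h) A.

Definition bias (p : player) : nat := if p is Maker then 1 else b.

(* A player facing fewer unclaimed elements than his bias claims them all. *)
Definition legal h A : bool :=
  (A \subset unclaimed h) &&
  (#|A| == minn (bias (to_move h)) #|unclaimed h|).

Definition finished h : bool := unclaimed h == set0.

(* Histories of the (possibly unfinished) plays in which Maker follows sigma
   and Breaker plays arbitrary legal moves. *)
Inductive play (sigma : seq {set T} -> {set T}) : seq {set T} -> Prop :=
| play_start : play sigma [::]
| play_Maker h : play sigma h -> ~~ finished h -> to_move h = Maker ->
    play sigma (rcons h (sigma h))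
| play_Breaker h A : play sigma h -> ~~ finished h -> to_move h = Breaker ->
    legal h A -> play sigma (rcons h A).

End MakerBreaker.

Fixpoint maker_claims (T : finType) (first : player) (h : seq {set T}) :
    {set T} :=
  if h is A :: h' then
    if first is Maker then A :|: maker_claims Breaker h'
    else maker_claims Maker h'
  else set0.

(* No play is infinite: Maker claims a new element in each of his turns. *)
Definition Maker_winning_strategy (T : finType) (X : {set T}) (b : nat)
    (first : player) (win : {set T} -> Prop)
    (sigma : seq {set T} -> {set T}) : Prop :=
  (forall h, play X b first sigma h -> ~~ finished X h ->
     to_move first h = Maker -> legal X b first h (sigma h)) /\
  (forall h, play X b first sigma h -> finished X h ->
     win (maker_claims first h)).

Definition Maker_wins (T : finType) (X : {set T}) (b : nat) (first : player)
    (win : {set T} -> Prop) : Prop :=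
  exists sigma, Maker_winning_strategy X b first win sigma.

(* A graph on 'I_n is given by its set of edges, two-element sets of vertices. *)
Definition edges_K (n : nat) : {set {set 'I_n}} :=
  [set e : {set 'I_n} | #|e| == 2].

Definition adj (n : nat) (G : {set {set 'I_n}}) : rel 'I_n :=
  fun x y => [set x; y] \in G.

(* [ucycle] is a graph cycle only from length 3 on, as is the case here. *)
Definition pancyclic (n : nat) (G : {set {set 'I_n}}) : Prop :=
  forall l : nat, 3 <= l <= n ->
    exists c : seq 'I_n, ucycle (adj G) c /\ size c = l.

(* Main.v *)
Require Import Defs.
From mathcomp Require Import all_boot all_order all_algebra boolp zify.

Set Implicit Arguments.
Unset Strict Implicit.
Unset Printing Implicit Defensive.

(** If [b^2] is at most a small multiple of [n], Maker can spend [O(b)] moves on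
    each of [n] tasks while Breaker claims only a small fraction of the edges.

    The basic device is a mini-game: Maker claims [8b] edges [u s], then one
    edge [z x] such that at least [4b] of the chords [f(s) g(x)] avoid Breaker's
    graph; Breaker cannot take all of these in one turn, so Maker claims one.

    Maker keeps a cyclic order of all vertices and repairs its defects, the
    consecutive pairs that are not his edges.  While there are more than [8b]
    defects, two moves remove one: a 2-opt exchange replaces the defect endpoint
    of largest Breaker degree by a vertex that has more than [b] free edges to
    other defects.  The sum of the squared Breaker degrees of the defect
    endpoints grows by [O(b^2)] per removed defect, so these degrees stay
    [O(b sqrt n)], a small fraction of [n].  The last [8b] defects are removed
    one by one with the mini-game (a 3-opt exchange), and all remaining defect
    endpoints are exchanged for vertices of low degree after each removal.

    Given the Hamilton cycle, each length is obtained with one mini-game: a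
    short cycle consists of two vertices and a segment of the Hamilton cycle,
    a long one is the closure of a segment by a 3-opt exchange. *)

(** * Forcing positions *)

Section Forcing.
Variables (T : finType) (X : {set T}) (b : nat) (win : {set T} -> Prop).
Implicit Types (A B M : {set T}) (h : seq {set T}).

(* Maker, to move, owns M and can reach a winning set.  The reply A of Breaker
   is not required to be unclaimed: only its size matters in what follows. *)
Inductive forces M B : Prop :=
| forces_done : win M -> forces M B
| forces_move e : e \in X -> e \notin M -> e \notin B ->
    (forall A, #|A| <= b -> forces (e |: M) (A :|: B)) -> forces M B.

(** When Maker already owns [e] no move is spent: the assumption with the empty reply is the current
    position. The strategy may thus request any edge of the board outside Breaker's graph. *)
Lemma forces_claim M B e : e \in X -> e \notin B ->
  (forall A, #|A| <= b -> forces (e |: M) (A :|: B)) -> forces M B.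
Proof.
move=> eX eB next; have [eM|eM] := boolP (e \in M); last exact: forces_move next.
have := next set0; rewrite cards0 set0U (setUidPr _) ?sub1set //; exact.
Qed.

Lemma iter_opponentN k p :
  iter k opponent (opponent p) = opponent (iter k opponent p).
Proof. by rewrite -iterSr. Qed.

Lemma maker_claims_rcons p h A : maker_claims p (rcons h A) =
  maker_claims p h :|: (if iter (size h) opponent p is Maker then A else set0).
Proof.
elim: h p => [|C h IH] p /=.
  by case: p => /=; rewrite ?setU0 ?set0U.
by rewrite -iter_opponentN; case: p; rewrite IH /= ?setUA.
Qed.

Lemma bigcup_claims p h :
  \bigcup_(A <- h) A = maker_claims p h :|: maker_claims (opponent p) h.
Proof.
elim: h p => [|C h IH] p /=; first by rewrite big_nil setU0.
by rewrite big_cons (IH Breaker); case: p => /=; rewrite setUA // setUC.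
Qed.

(** The strategy picks, by classical choice, any unclaimed edge after which the position stays
    forcing. Monotonicity is needed because [forces] may stop before the board is full. The initial
    [B] accounts for a first turn of Breaker. *)
Lemma forces_Maker_wins b0 first :
    b0 <= b -> (forall M M', M \subset M' -> win M -> win M') ->
    (forall B, #|B| <= b -> forces set0 B) ->
  Maker_wins X b0 first win.
Proof.
move=> b0b win_mono start.
pose mk h := @maker_claims T first h.
pose br h := @maker_claims T (opponent first) h.
pose good h e := e \in unclaimed X h /\
  forall A, #|A| <= b -> forces (e |: mk h) (A :|: br h).
pose sigma h := if [pick e | `[< good h e >]] is Some e then [set e] else set0.
exists sigma.
have unclE h e : (e \in unclaimed X h) = [&& e \in X, e \notin mk h & e \notin br h].
  by rewrite /unclaimed (bigcup_claims first) !inE negb_or andbC andbA.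
have goodP h : forces (mk h) (br h) -> ~~ finished X h ->
    exists2 e, sigma h = [set e] & good h e.
  move=> Fh /set0Pn[e0 e0h]; rewrite /sigma; case: pickP => [e /asboolP ge|no].
    by exists e.
  have [e ge] : exists e, good h e.
    case: Fh => [w|e eX eM eB next].
      exists e0; split=> // A _; apply: forces_done.
      by apply: win_mono w; apply: subsetUr.
    by exists e; split=> //; rewrite unclE eX eM.
  by have /asboolP := ge; rewrite no.
(* On Breaker's turn the invariant asks that every reply of size at most [b] lead to a forcing
   position. *)
have inv h : play X b0 first sigma h ->
    if to_move first h is Maker then forces (mk h) (br h)
    else forall A, #|A| <= b -> forces (mk h) (A :|: br h).
  elim=> {h} [|h _ IH nf tm|h A _ IH nf tm /andP[_ /eqP cA]].
  - rewrite /to_move /mk /br /=; case: (first) => [|A Ab]; first by apply: start; rewrite cards0.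
    by rewrite setU0; apply: start.
  - rewrite tm in IH; have [e -> [_ next]] := goodP _ IH nf.
    rewrite /to_move size_rcons iterS -/(to_move first h) tm /= => C Cb.
    rewrite /mk /br !maker_claims_rcons iter_opponentN -/(to_move first h) tm /=.
    by rewrite setU0 setUC; apply: next.
  - rewrite tm in IH cA.
    rewrite /to_move size_rcons iterS -/(to_move first h) tm /=.
    rewrite /mk /br !maker_claims_rcons iter_opponentN -/(to_move first h) tm /=.
    rewrite setU0 setUC; apply: IH.
    by rewrite cA (leq_trans (geq_minl _ _)).
split=> h ph.
  move=> nf tm; have := inv h ph; rewrite tm => Fh.
  have [e -> [eu _]] := goodP h Fh nf.
  rewrite /legal sub1set eu cards1 tm /= /minn.
  case: ltnP => // /(leq_trans _) le1.
  by rewrite eqn_leq le1 ?andbT ?card_gt0 //.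
move=> fin.
have Fh : forces (mk h) (br h).
  have := inv h ph; case: (to_move first h) => // /(_ set0).
  by rewrite cards0 set0U; apply.
case: Fh => // e eX eM eB _.
have : e \in unclaimed X h by rewrite unclE eX eM.
by rewrite (eqP fin) inE.
Qed.

End Forcing.

(** * Sums over the arcs of a cyclic sequence *)

Section PathSums.
Variable V : Type.
Implicit Types (F G : V -> V -> nat) (g : V -> nat) (x y h : V) (p s t c : seq V).

Fixpoint pathsum F x s :=
  if s is y :: t then F x y + pathsum F y t else 0.

Definition cycsum F c := if c is x :: s then pathsum F x (rcons s x) else 0.

Lemma pathsum_cat F x s t :
  pathsum F x (s ++ t) = pathsum F x s + pathsum F (last x s) t.
Proof. by elim: s x => [|y s IH] x //=; rewrite IH addnA. Qed.

Lemma pathsum_rcons F x s y :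
  pathsum F x (rcons s y) = pathsum F x s + F (last x s) y.
Proof. by rewrite -cats1 pathsum_cat /= addn0. Qed.

Lemma cycsum_cons F x s :
  cycsum F (x :: s) = pathsum F x s + F (last x s) x.
Proof. exact: pathsum_rcons. Qed.

Lemma last_rev_belast x s : last (last x s) (rev (belast x s)) = x.
Proof. by case: s => //= y s; rewrite rev_cons last_rcons. Qed.

Lemma pathsum_rev F x s : (forall x y, F x y = F y x) ->
  pathsum F (last x s) (rev (belast x s)) = pathsum F x s.
Proof.
move=> symF; elim: s x => //= y s IH x.
by rewrite rev_cons pathsum_rcons IH last_rev_belast symF addnC.
Qed.

Lemma leq_pathsum F G x s :
  (forall x y, F x y <= G x y) -> pathsum F x s <= pathsum G x s.
Proof. by move=> leFG; elim: s x => //= y s IH x; apply: leq_add. Qed.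

Lemma leq_cycsum F G c : (forall x y, F x y <= G x y) -> cycsum F c <= cycsum G c.
Proof. by case: c => //= x s leFG; apply: leq_pathsum. Qed.

(** A zero sum of [E] encodes a property shared by all arcs of the cycle, which can then be assumed
    arc by arc. *)
Lemma leq_cycsum_cond (E : V -> V -> nat) F G c :
  (forall x y, E x y = 0 -> F x y <= G x y) -> cycsum E c = 0 ->
  cycsum F c <= cycsum G c.
Proof.
move=> EFG; case: c => //= x s; move: (rcons s x) => t.
elim: t x => //= y t IH x /eqP; rewrite addn_eq0 => /andP[/eqP Exy /eqP Et].
by rewrite leq_add ?EFG ?IH.
Qed.

Lemma pathsum_add F G x s :
  pathsum (fun x y => F x y + G x y) x s = pathsum F x s + pathsum G x s.
Proof. by elim: s x => //= y s IH x; rewrite IH addnACA. Qed.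

Lemma cycsum_add F G c :
  cycsum (fun x y => F x y + G x y) c = cycsum F c + cycsum G c.
Proof. by case: c => //= x s; rewrite pathsum_add. Qed.

Lemma pathsum_const k x s : pathsum (fun _ _ => k) x s = k * size s.
Proof. by elim: s x => //= [|y s IH] x; rewrite ?muln0 // IH mulnS. Qed.

Lemma pathsum_scale k F x s :
  pathsum (fun x y => k * F x y) x s = k * pathsum F x s.
Proof. by elim: s x => //= [|y s IH] x; rewrite ?muln0 // IH mulnDr. Qed.

Lemma cycsum_scale k F c : cycsum (fun x y => k * F x y) c = k * cycsum F c.
Proof. by case: c => [|x s] /=; rewrite ?muln0 // pathsum_scale. Qed.

Lemma pathsum_vertex g g' x s :
  pathsum (fun x y => g x + g' y) x s =
    \sum_(y <- belast x s) g y + \sum_(y <- s) g' y.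
Proof.
elim: s x => //= [|y s IH] x; first by rewrite !big_nil.
by rewrite IH !big_cons addnACA.
Qed.

Lemma cycsum_vertex g c :
  cycsum (fun x y => g x + g y) c = 2 * \sum_(x <- c) g x.
Proof.
case: c => [|x s] /=; first by rewrite big_nil.
by rewrite pathsum_vertex belast_rcons -cats1 big_cat big_seq1 big_cons /=; lia.
Qed.

Lemma cycsum_sum (I : finType) (F : I -> V -> V -> nat) c :
  \sum_i cycsum (F i) c = cycsum (fun x y => \sum_i F i x y) c.
Proof.
case: c => [|x s] /=; first by rewrite big1.
move: (rcons s x) => t; elim: t x => [|y t IH] x /=; first by rewrite big1.
by rewrite big_split IH.
Qed.

Lemma pathsum_lt_split F G x s : pathsum F x s < pathsum G x s ->
  exists p1 y p2, s = p1 ++ y :: p2 /\ F (last x p1) y < G (last x p1) y.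
Proof.
elim: s x => //= y s IH x lt.
have [ltxy|lexy] := ltnP (F x y) (G x y); first by exists [::], y, s.
have /IH [p1 [z [p2 [-> ltz]]]] : pathsum F y s < pathsum G y s by lia.
by exists (y :: p1), z, p2.
Qed.

(** Cuts a path the way a 3-opt exchange needs it: the middle segment runs from position [i] to
    position [j]. *)
Lemma seq_split3 h t i j :
  0 < i -> i <= j -> j < size t -> exists p1 (x : V) p2 y p3,
    [/\ t = p1 ++ x :: p2 ++ y :: p3, x = nth h (h :: t) i,
        last h p1 = nth h (h :: t) i.-1, last x p2 = nth h (h :: t) j &
        y = nth h (h :: t) j.+1].
Proof.
case: i => // i _ ij jt; have it : i < size t by apply: leq_trans (ltnW jt).
exists (take i t), (nth h t i), (take (j - i.+1) (drop i.+1 t)), (nth h t j), (drop j.+1 t).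
have ed : nth h t i :: drop i.+1 t = drop i t by rewrite -drop_nth.
split=> //.
- have -> : nth h t j :: drop j.+1 t = drop (j - i.+1) (drop i.+1 t).
    by rewrite drop_drop subnK // -drop_nth.
  by rewrite cat_take_drop ed cat_take_drop.
- by rewrite (last_nth h) size_take it /=; case: i it {ij ed} => //= i it; rewrite nth_take.
- rewrite (last_nth h) size_take size_drop.
  have -> : (if j - i.+1 < size t - i.+1 then j - i.+1 else size t - i.+1) = j - i.+1.
    by case: ltnP => //; lia.
  have -> : nth h t i :: take (j - i.+1) (drop i.+1 t) = take (j - i) (drop i t).
    by rewrite -ed -(subnSK ij).
  rewrite nth_take; last by lia.
  by rewrite nth_drop; case: j ij {jt} => // j ij /=; congr (nth _ _ _); lia.
Qed.

(** Both sides are the entry of [c] at position j + k modulo its length. Hence, without repetitions,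
    the entry at a fixed position is injective in the rotation. *)
Lemma nth_rotC (d : V) c j k : j < size c -> k < size c ->
  nth d (rot k c) j = nth d (rot j c) k.
Proof.
move=> js ks; rewrite /rot !nth_cat !size_drop !nth_drop.
case: ltnP => h1; case: ltnP => h2; rewrite ?nth_take ?(addnC k) //; try lia.
congr nth; lia.
Qed.

End PathSums.

(** * Rotation and reversal of cycles *)

Section SameCycle.
Variable V : eqType.
Implicit Types (F : V -> V -> nat) (h x y : V) (s t c p : seq V).

(* Rotations and reversals of a cycle have the same arcs. *)
Definition same_cycle c c' := perm_eq c c' /\
  forall F, (forall x y, F x y = F y x) -> cycsum F c = cycsum F c'.

Lemma same_cycle_rot s t : same_cycle (s ++ t) (t ++ s).
Proof.
split=> [|F _]; first by rewrite perm_catC.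
case: s t => [|x s] [|y t]; rewrite ?cats0 //.
by rewrite /= !rcons_cat /= !pathsum_cat /= !pathsum_rcons; lia.
Qed.

Lemma same_cycle_rev c : same_cycle c (rev c).
Proof.
split=> [|F symF]; first by rewrite perm_sym perm_rev.
case: c => // x s; rewrite lastI rev_rcons -lastI !cycsum_cons.
by rewrite pathsum_rev // last_rev_belast symF.
Qed.

Lemma same_cycle_trans c1 c2 c3 :
  same_cycle c1 c2 -> same_cycle c2 c3 -> same_cycle c1 c3.
Proof.
move=> [p12 e12] [p23 e23]; split=> [|F symF]; first exact: perm_trans p23.
by rewrite e12 // e23.
Qed.

(** A rotation turns any arc into the closing one, the normal form in which defects are repaired. *)
Lemma cycsum_gt0 F c : 0 < cycsum F c ->
  exists h t, same_cycle c (h :: t) /\ 0 < F (last h t) h.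
Proof.
case: c => // x s; rewrite cycsum_cons addn_gt0 => /orP[Fs|Fx]; last by exists x, s.
have : pathsum (fun _ _ => 0) x s < pathsum F x s by rewrite pathsum_const.
move=> lt; have [p1 [y [p2 [-> Fy]]]] := pathsum_lt_split lt.
exists y, (p2 ++ x :: p1); rewrite last_cat; split=> //.
exact: same_cycle_rot (x :: p1) (y :: p2).
Qed.

Lemma same_cycle_flip h t : exists h' t',
  same_cycle (h :: t) (h' :: t') /\ (h', last h' t') = (last h t, h).
Proof.
exists (last h t), (rev (belast h t)).
rewrite -rev_rcons -lastI; split; first exact: same_cycle_rev.
by rewrite last_rev_belast.
Qed.

Lemma uniq_last_neq h y p1 p2 :
  uniq (h :: p1 ++ y :: p2) -> last h p1 != last y p2.
Proof.
rewrite -cat_cons cat_uniq => /and3P[_ /hasPn dis _].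
by apply/eqP => e; have := dis _ (mem_last y p2); rewrite -e /= mem_last.
Qed.

End SameCycle.

Arguments cycsum : simpl never.

(** * Degrees and defects *)

Definition vsum n (g : 'I_n -> nat) := \sum_v g v.

Lemma sum_uniq_le n (s : seq 'I_n) (g : 'I_n -> nat) :
  uniq s -> \sum_(v <- s) g v <= vsum g.
Proof.
move=> us; rewrite /vsum big_uniq //= [leqRHS](bigID (mem s)) /=.
exact: leq_addr.
Qed.

Lemma sum_map_le n (S : seq nat) (f : nat -> 'I_n) (g : 'I_n -> nat) :
  uniq S -> {in S &, injective f} -> \sum_(i <- S) g (f i) <= vsum g.
Proof.
by move=> uS injf; rewrite -(big_map f xpredT) sum_uniq_le // map_inj_in_uniq.
Qed.

(** Union bound: [g] will be a sum of indicators of forbidden events, and a zero avoids all of them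
    at once. *)
Lemma seq_pick0 (S : seq nat) (g : nat -> nat) :
  \sum_(i <- S) g i < size S -> exists2 i, i \in S & g i = 0.
Proof.
elim: S => //= i S IH; rewrite big_cons.
have [gi0 _|gi] := posnP (g i); first by exists i; rewrite ?mem_head.
move=> lt; have /IH [j jS gj] : \sum_(i <- S) g i < size S by lia.
by exists j; rewrite // inE jS orbT.
Qed.

Lemma leq_sum_const (S : seq nat) (g : nat -> nat) k :
  (forall i, i \in S -> g i <= k) -> \sum_(i <- S) g i <= size S * k.
Proof.
elim: S => [|i S IH] gk; rewrite ?big_nil // big_cons mulSn leq_add ?gk ?mem_head //.
by apply: IH => j jS; rewrite gk // inE jS orbT.
Qed.

Lemma leq_sum_mem (S T : seq nat) :
  uniq S -> \sum_(i <- S) (i \in T) <= size T.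
Proof.
move=> uS; rewrite -big_mkcond /= sum1_count -size_filter.
apply: uniq_leq_size; first exact: filter_uniq.
by move=> i; rewrite mem_filter => /andP[].
Qed.

Section Degrees.
Variable n : nat.
Implicit Types (x y h u v w : 'I_n) (p t c : seq 'I_n).
Implicit Types (A B M : {set {set 'I_n}}) (g : 'I_n -> nat).

Local Notation one := (fun _ : 'I_n => 1).

Definition joined B x y : nat := [set x; y] \in B.

Definition deg B v := vsum (joined B v).

Lemma joinedC B x y : joined B x y = joined B y x.
Proof. by rewrite /joined setUC. Qed.

Lemma joined_setU A B x y : joined (A :|: B) x y <= joined A x y + joined B x y.
Proof. by rewrite /joined inE; case: (_ \in A); case: (_ \in B). Qed.

Lemma deg_setU A B v : deg (A :|: B) v <= deg A v + deg B v.
Proof. by rewrite -big_split; apply: leq_sum => w _; apply: joined_setU. Qed.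

Lemma set2_inj v : injective (fun w => [set v; w]).
Proof.
move=> w w' /= e; have : w' \in [set v; w] by rewrite e !inE eqxx orbT.
rewrite !inE => /orP[/eqP wv|/eqP-> //].
have : w \in [set v; w'] by rewrite -e !inE eqxx orbT.
by rewrite !inE wv orbb => /eqP.
Qed.

Lemma deg_card A v : deg A v <= #|A|.
Proof.
rewrite /deg /vsum -big_mkcond sum1_card -(card_imset _ (@set2_inj v)).
by apply/subset_leq_card/subsetP => _ /imsetP[w wA ->].
Qed.

Lemma card_set2_eq (e : {set 'I_n}) :
  \sum_(p : 'I_n * 'I_n) ([set p.1; p.2] == e) <= 2.
Proof.
rewrite -big_mkcond sum1_card.
have [/existsP[[x y] /= /eqP <-]|no] := boolP [exists p : 'I_n * 'I_n, [set p.1; p.2] == e]; last first.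
  rewrite eq_card0 // => p; apply/negbTE.
  by move: no; rewrite negb_exists => /forallP/(_ p).
apply: leq_trans (_ : #|[set (x, y); (y, x)]| <= 2); last by rewrite cards2; case: eqP.
apply/subset_leq_card/subsetP => -[v w] vw.
have e1 : [set v; w] = [set x; y] by apply/eqP; exact: vw.
have : v \in [set x; y] by rewrite -e1 !inE eqxx.
rewrite !inE !xpair_eqE => /orP[]/eqP v1; move: e1; rewrite v1.
  by move/set2_inj ->; rewrite !eqxx.
by rewrite [RHS]setUC => /set2_inj ->; rewrite !eqxx orbT.
Qed.

(** Double counting: every edge arises from at most two ordered pairs. *)
Lemma sum_deg B : vsum (deg B) <= 2 * #|B|.
Proof.
rewrite /vsum pair_bigA /= mulnC -sum_nat_const.
apply: leq_trans (_ : \sum_(e in B) \sum_(p : 'I_n * 'I_n) ([set p.1; p.2] == e) <= _).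
  rewrite exchange_big /=; apply: leq_sum => p _; rewrite /joined.
  by case: (boolP (_ \in B)) => // pB; rewrite (bigD1 _ pB) /= eqxx.
by apply: leq_sum => e _; apply: card_set2_eq.
Qed.

Definition highdeg k B v : nat := n < k * deg B v.

(** Markov's inequality for the degree sum, free of division. *)
Lemma few_highdeg k B : n * vsum (highdeg k B) <= 2 * k * #|B|.
Proof.
rewrite /vsum big_distrr /=; apply: leq_trans (_ : \sum_v k * deg B v <= _).
  by apply: leq_sum => v _; rewrite /highdeg; case: ltnP => /=; lia.
by rewrite -big_distrr /= -mulnA mulnCA leq_mul2l sum_deg orbT.
Qed.

(* With weight 1, the sum of [defect M] over a cycle is twice the number of arcs
   outside M; with a general weight it sums g over the endpoints of these arcs. *)
Definition defect M g x y := ([set x; y] \notin M) * (g x + g y).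

Lemma defectC M g x y : defect M g x y = defect M g y x.
Proof. by rewrite /defect setUC addnC. Qed.

Lemma defect_sub M M' g x y : M \subset M' -> defect M' g x y <= defect M g x y.
Proof.
move=> /subsetP sM; rewrite /defect leq_mul2r.
by case: (boolP (_ \in M)) => [/sM ->|_]; rewrite ?orbT // leq_b1 orbT.
Qed.

Lemma defect0 M g x y : [set x; y] \in M -> defect M g x y = 0.
Proof. by rewrite /defect => ->. Qed.

Lemma cycsum_defect_sub M M' g c : M \subset M' ->
  cycsum (defect M' g) c <= cycsum (defect M g) c.
Proof. by move=> sM; apply: leq_cycsum => x y; apply: defect_sub. Qed.

(** Reversing the segment from [y] on replaces its entering arc and the closing arc by a Maker edge
    and the arc from [y] to [h]; inside the segment nothing changes because [defect] is symmetric.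
    Quantifying over [g] lets one exchange control both the number of defects and the degrees of
    their endpoints. *)
Lemma two_opt M M' g h p1 y p2 : M \subset M' ->
    [set last h p1; last y p2] \in M' ->
  cycsum (defect M' g) (h :: p1 ++ last y p2 :: rev (belast y p2)) +
    defect M g (last h p1) y + defect M g (last y p2) h
  <= cycsum (defect M g) (h :: p1 ++ y :: p2) + defect M' g y h.
Proof.
move=> sM xa; rewrite !cycsum_cons !pathsum_cat !last_cat /=.
rewrite (defect0 g xa) last_rev_belast (pathsum_rev _ _ (defectC M' g)).
have L x s : pathsum (defect M' g) x s <= pathsum (defect M g) x s.
  by apply: leq_pathsum => ? ?; apply: defect_sub.
by have := L h p1; have := L y p2; lia.
Qed.

(** The last two segments are swapped and one of them is reversed. All three new arcs are Maker
    edges, so the closing defect disappears and no new one arises. *)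
Lemma three_opt M M' g h p1 s p2 y p3 : M \subset M' ->
    [set h; s] \in M' -> [set last h p1; y] \in M' ->
    [set last y p3; last s p2] \in M' ->
  cycsum (defect M' g) (h :: p1 ++ y :: p3 ++ last s p2 :: rev (belast s p2)) +
    defect M g (last y p3) h
  <= cycsum (defect M g) (h :: p1 ++ s :: p2 ++ y :: p3).
Proof.
move=> sM hs py zx; rewrite !cycsum_cons !pathsum_cat /= !pathsum_cat /= !last_cat /= !last_cat /=.
rewrite (defect0 g py) (defect0 g zx) last_rev_belast (pathsum_rev _ _ (defectC M' g)).
rewrite (defectC _ _ s) (defect0 g hs).
have L x t : pathsum (defect M' g) x t <= pathsum (defect M g) x t.
  by apply: leq_pathsum => ? ?; apply: defect_sub.
by have := L h p1; have := L y p3; have := L s p2; lia.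
Qed.

Lemma defect_notin M g x y : [set x; y] \notin M -> defect M g x y = g x + g y.
Proof. by rewrite /defect => ->; rewrite mul1n. Qed.

Lemma defect_gt0 M g x y : 0 < defect M g x y -> [set x; y] \notin M.
Proof. by rewrite /defect; case: (_ \in M). Qed.

Lemma defect_le M g x y : defect M g x y <= g x + g y.
Proof. by rewrite /defect; case: (_ \in M); rewrite /= ?mul1n. Qed.

Lemma defect_add M g g' x y :
  defect M (fun v => g v + g' v) x y = defect M g x y + defect M g' x y.
Proof. by rewrite /defect -mulnDr addnACA. Qed.

Lemma leq_defect_cond M c (e g g' : 'I_n -> nat) :
    cycsum (defect M e) c = 0 -> (forall v, e v = 0 -> g v <= g' v) ->
  cycsum (defect M g) c <= cycsum (defect M g') c.
Proof.
move=> e0 le; apply: leq_cycsum_cond e0 => x y; rewrite /defect.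
case: (_ \in M) => //; rewrite !mul1n => /eqP.
by rewrite addn_eq0 => /andP[/eqP ex /eqP ey]; rewrite leq_add ?le.
Qed.

Lemma leq_defect M c g g' : (forall v, g v <= g' v) ->
  cycsum (defect M g) c <= cycsum (defect M g') c.
Proof.
move=> le; apply: leq_cycsum => x y; rewrite /defect leq_mul2l leq_add ?orbT //.
Qed.

Lemma defect_arc M g c : 0 < cycsum (defect M g) c ->
  exists h t, [/\ same_cycle c (h :: t), [set last h t; h] \notin M & 0 < g (last h t)].
Proof.
move=> /cycsum_gt0[h [t [cht pos]]]; have bad := defect_gt0 pos.
move: pos; rewrite defect_notin // addn_gt0 => /orP[ga|gh]; first by exists h, t.
have [h' [t' [e [e1 e2]]]] := same_cycle_flip h t.
by exists h', t'; split; [apply: same_cycle_trans e|rewrite e2 e1 setUC|rewrite e2].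
Qed.

Lemma same_cycle_spanning c c' : same_cycle c c' ->
  uniq c -> size c = n -> uniq c' /\ size c' = n.
Proof. by move=> [p _] uc sc; rewrite -(perm_uniq p) -(perm_size p). Qed.

Lemma same_cycle_defect M g c c' : same_cycle c c' ->
  cycsum (defect M g) c = cycsum (defect M g) c'.
Proof. by move=> [_ e]; apply: e => x y; apply: defectC. Qed.

(** The greatest threshold reached by some defect endpoint is attained. The zero sum says that no
    defect endpoint has larger weight than the chosen one. *)
Lemma max_endpoint M g c : 0 < cycsum (defect M one) c ->
  exists h t, [/\ same_cycle c (h :: t), [set last h t; h] \notin M &
    cycsum (defect M (fun v => g (last h t) < g v)) c = 0].
Proof.
move=> pos; pose P k := 0 < cycsum (defect M (fun v => k <= g v)) c.
have P0 : P 0 by [].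
have bnd k : P k -> k <= vsum g.
  move=> /defect_arc[h [t [_ _]]]; rewrite lt0b => le.
  by rewrite (leq_trans le) // /vsum (bigD1 (last h t)) //= leq_addr.
case: (ex_maxnP (ex_intro _ 0 P0) bnd) => m Pm maxm.
have [h [t [cht bad]]] := defect_arc Pm; rewrite lt0b => ma.
exists h, t; split=> //; apply/eqP; rewrite -leqn0 leqNgt; apply/negP => Pa.
by have := maxm _ Pa; move: ma; clear; lia.
Qed.

(** Each vertex is the tail of at most one arc and the head of at most one, so the two weights
    cannot spoil all [size t] arcs. *)
Lemma sum_path_lt_split h t g g' : uniq (h :: t) ->
    vsum g + vsum g' < size t ->
  exists p1 y p2, [/\ t = p1 ++ y :: p2, g (last h p1) = 0 & g' y = 0].
Proof.
move=> uht lt.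
have : pathsum (fun x y => g x + g' y) h t < pathsum (fun _ _ => 1) h t.
  rewrite pathsum_const mul1n (leq_ltn_trans _ lt) // pathsum_vertex leq_add ?sum_uniq_le //.
    by move: uht; rewrite lastI rcons_uniq => /andP[].
  by case/andP: uht.
move=> ltp; have [p1 [y [p2 [->]]]] := pathsum_lt_split ltp; rewrite ltnS leqn0 addn_eq0.
by case/andP=> /eqP g0 /eqP g'0; exists p1, y, p2.
Qed.

Lemma perm_two_opt h p1 y p2 :
  perm_eq (h :: p1 ++ y :: p2) (h :: p1 ++ last y p2 :: rev (belast y p2)).
Proof.
by rewrite perm_cons perm_cat2l -rev_rcons -lastI perm_sym perm_rev.
Qed.

Lemma pathsum_claim M g v w h t : v \notin h :: t ->
  pathsum (defect ([set w; v] |: M) g) h t = pathsum (defect M g) h t.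
Proof.
elim: t h => //= y t IH h; rewrite !inE !negb_or => /and3P[vh vy vt].
rewrite IH ?inE ?negb_or ?vy //; congr (_ + _); rewrite /defect !inE.
suff /negbTE-> : [set h; y] != [set w; v] by [].
apply/eqP => /setP/(_ v); rewrite !inE eqxx orbT.
by rewrite (negbTE vh) (negbTE vy).
Qed.

Lemma vsum_joined B x : vsum (fun v => joined B v x) = deg B x.
Proof. by apply: eq_bigr => v _; apply: joinedC. Qed.

(** Double counting of the Breaker edges between all vertices and the defect endpoints. *)
Lemma cycsum_defect_deg M B c :
  vsum (fun v => cycsum (defect M (joined B v)) c) = cycsum (defect M (deg B)) c.
Proof.
rewrite /vsum cycsum_sum; case: c => // x s; rewrite /cycsum; move: (rcons s x) => t.
elim: t x => //= y t IH x; rewrite IH; congr (_ + _).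
rewrite /defect -big_distrr /= big_split /=.
by rewrite -!/(vsum _) !vsum_joined.
Qed.

Lemma perm_three_opt h p1 (s : 'I_n) p2 y p3 :
  perm_eq (h :: p1 ++ s :: p2 ++ y :: p3)
    (h :: p1 ++ y :: p3 ++ last s p2 :: rev (belast s p2)).
Proof.
rewrite perm_cons perm_cat2l -rev_rcons -lastI -cat_cons -[y :: p3 ++ _]cat_cons.
by rewrite perm_catC perm_cat2l perm_sym perm_rev.
Qed.

Lemma defect_zero_imp M c (e g : 'I_n -> nat) : cycsum (defect M e) c = 0 ->
  (forall v, e v = 0 -> g v = 0) -> cycsum (defect M g) c = 0.
Proof.
move=> e0 eg; apply/eqP; rewrite -leqn0.
apply: leq_trans (leq_defect_cond (g' := fun=> 0) e0 _) _.
  by move=> v /eg->.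
apply: leq_trans (_ : cycsum (fun x y => 0 * 0) c <= 0); last by rewrite cycsum_scale.
by apply: leq_cycsum => x y; rewrite /defect addn0 muln0.
Qed.

Lemma defect_zero_closing M g h t : cycsum (defect M g) (h :: t) = 0 ->
  [set last h t; h] \notin M -> g (last h t) = 0 /\ g h = 0.
Proof.
move=> /eqP; rewrite cycsum_cons addn_eq0 => /andP[_ /eqP].
move=> d0 bad; move: d0; rewrite (defect_notin _ bad) => /eqP.
by rewrite addn_eq0 => /andP[/eqP ? /eqP ?].
Qed.

Lemma highdeg0 k B v : (highdeg k B v = 0) <-> (k * deg B v <= n).
Proof.
by rewrite leqNgt /highdeg; case: ltnP.
Qed.

End Degrees.

(** * Maker's strategy *)

Section Strategy.
Variables (n b : nat) (win : {set {set 'I_n}} -> Prop).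
Hypotheses (b_gt0 : 0 < b) (b_small : 4000 * (4000 * (b * b)) <= n).
Implicit Types (x y h u v w z : 'I_n) (p t c : seq 'I_n).
Implicit Types (A B M : {set {set 'I_n}}) (g : 'I_n -> nat).

Local Notation forces := (forces (edges_K n) b win).
Local Notation one := (fun _ : 'I_n => 1).
Local Notation sqdeg B := (fun v => deg B v * deg B v).

(** [k] counts turns of Breaker; only the total size of what he added is kept. *)
Definition grows k B B' := exists2 A : {set {set 'I_n}}, #|A| <= k * b & B' = A :|: B.

Lemma grows0 B : grows 0 B B.
Proof. by exists set0; rewrite ?cards0 ?set0U. Qed.

Lemma grows_trans k1 k2 B1 B2 B3 :
  grows k1 B1 B2 -> grows k2 B2 B3 -> grows (k1 + k2) B1 B3.
Proof.
move=> [A1 A1b ->] [A2 A2b ->]; exists (A2 :|: A1); last by rewrite setUA.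
by rewrite (leq_trans (leq_card_setU _ _)) // mulnDl addnC leq_add.
Qed.

Lemma grows_leq k1 k2 B1 B2 : k1 <= k2 -> grows k1 B1 B2 -> grows k2 B1 B2.
Proof.
move=> le12 [A Ab ->]; exists A => //.
by rewrite (leq_trans Ab) // leq_mul2r le12 orbT.
Qed.

Lemma growsS k B B' A : grows k B B' -> #|A| <= b -> grows k.+1 B (A :|: B').
Proof.
move=> gk Ab; rewrite -addn1; apply: grows_trans gk _.
by exists A; rewrite ?mul1n.
Qed.

Lemma grows_deg k B B' v : grows k B B' -> deg B' v <= deg B v + k * b.
Proof.
move=> [A Ab ->]; rewrite (leq_trans (deg_setU _ _ _)) // addnC leq_add2l.
exact: leq_trans (deg_card _ _) Ab.
Qed.

Lemma grows_card k B B' : grows k B B' -> #|B'| <= #|B| + k * b.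
Proof.
by move=> [A Ab ->]; rewrite (leq_trans (leq_card_setU _ _)) // addnC leq_add2l.
Qed.

Lemma leq_bb : b <= b * b.
Proof. exact: leq_pmulr. Qed.

Lemma edge_in_K x y : x != y -> [set x; y] \in edges_K n.
Proof. by rewrite inE cards2 => ->. Qed.

Lemma joined0 B x y : joined B x y = 0 -> [set x; y] \notin B.
Proof. by rewrite /joined; case: (_ \in B). Qed.

Lemma few_highdeg100 B : 100 * (200 * #|B|) <= n * n ->
  100 * vsum (highdeg 100 B) <= n.
Proof.
move=> Bn; have := few_highdeg 100 B; nia.
Qed.

(** * The mini-game: a star at [u], one edge at [z], one chord *)

Section MiniGame.
Variables (M B : {set {set 'I_n}}) (u z : 'I_n) (S X : seq nat).
Variables (s f x g : nat -> 'I_n).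
Hypotheses (uS : uniq S) (uX : uniq X).
Hypotheses (s_inj : {in S &, injective s}) (f_inj : {in S &, injective f}).
Hypotheses (x_inj : {in X &, injective x}) (g_inj : {in X &, injective g}).
Hypotheses (S_large : n <= 8 * size S) (X_large : n <= 8 * size X).
Hypothesis s_neq : forall i, i \in S -> u != s i.
Hypothesis x_neq : forall j, j \in X -> z != x j.
Hypothesis fg_neq : forall i j, i \in S -> j \in X -> f i != g j.
Hypotheses (u_low : 100 * deg B u <= n) (z_low : 100 * deg B z <= n).
Hypothesis B_small : 100 * (200 * #|B|) <= n * n.

(** Indices already used, taken by Breaker at [u], or with [f i] of high degree are together fewer
    than n/8. Low degree of the [f i] is what the later averaging over chords uses. *)
Lemma build_star k (I : seq nat) M' B' : size I + k = 8 * b -> uniq I -> {subset I <= S} ->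
    M \subset M' -> grows (size I) B B' ->
    (forall i, i \in I -> [set u; s i] \in M' /\ 100 * deg B (f i) <= n) ->
    (forall (I : seq nat) M' B', size I = 8 * b -> uniq I -> {subset I <= S} ->
       M \subset M' -> grows (8 * b) B B' ->
       (forall i, i \in I -> [set u; s i] \in M' /\ 100 * deg B (f i) <= n) ->
       forces M' B') ->
  forces M' B'.
Proof.
move=> sz uI IS sM gB good fin.
elim: k I M' B' sz uI IS sM gB good => [|k IH] I M' B' sz uI IS sM gB good.
  by apply: (fin I) => //; rewrite -?sz addn0.
have [i iS] : exists2 i, i \in S &
    (i \in I) + joined B' u (s i) + highdeg 100 B (f i) = 0.
  apply: seq_pick0; rewrite !big_split /=.
  apply: leq_ltn_trans (leq_add (leq_add (leq_sum_mem I uS)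
    (sum_map_le (joined B' u) uS s_inj)) (sum_map_le (highdeg 100 B) uS f_inj)) _.
  rewrite -/(deg B' u).
  have := few_highdeg100 B_small; have := grows_deg u gB.
  have : size I * b <= 8 * (b * b) by rewrite mulnA leq_mul2r -sz leq_addr orbT.
  by have := leq_bb; lia.
move=> /eqP; rewrite !addn_eq0 eqb0 => /andP[/andP[iI /eqP/joined0 ub]].
rewrite eqb0 -leqNgt => fi.
apply: (forces_claim _ ub); first by apply/edge_in_K/s_neq.
move=> A Ab; apply: (IH (i :: I)) => //=.
- by rewrite -sz addSnnS.
- by rewrite iI.
- by move=> j; rewrite inE => /orP[/eqP->|/IS].
- exact: subset_trans sM (subsetUr _ _).
- exact: growsS.
- move=> j; rewrite inE => /orP[/eqP->|/good[uj fj]].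
    by rewrite setU11.
  by rewrite setU1r.
Qed.

Lemma mini_game :
    (forall M' B' i j, M \subset M' -> grows (10 * b) B B' -> i \in S -> j \in X ->
       [set u; s i] \in M' -> [set z; x j] \in M' -> [set f i; g j] \in M' ->
       forces M' B') ->
  forces M B.
Proof.
move=> fin; apply: (@build_star (8 * b) [::]) => //; first exact: grows0.
move=> I M1 B1 szI uI IS sM1 gB1 good.
have f_injI : {in I &, injective f} by move=> ? ? /IS ? /IS ?; apply: f_inj.
(* [hit j] counts the chords at [g j] that Breaker owns. *)
pose hit j := \sum_(i <- I) joined B1 (f i) (g j).
have sum_hit : \sum_(j <- X) hit j <= \sum_(i <- I) deg B1 (f i).
  rewrite exchange_big /=; apply: leq_sum => i _.
  exact: (sum_map_le (joined B1 (f i))).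
have sum_hit2 : 100 * (\sum_(j <- X) hit j) <= 8 * b * (n + 800 * (b * b)).
  rewrite (leq_trans (leq_mul (leqnn 100) sum_hit)) // -szI big_distrr /=.
  apply: leq_sum_const => i /good[_ fi].
  by have := grows_deg (f i) gB1; lia.
(* Breaker owns at most 8b(n/100 + 8b^2) chords, so [hit j] exceeds 4b for at most n/50 + 16b^2
   indices. *)
have [j jX] : exists2 j, j \in X & joined B1 z (x j) + (4 * b < hit j) = 0.
  apply: seq_pick0; rewrite big_split /=.
  apply: leq_ltn_trans (leq_add (sum_map_le (joined B1 z) uX x_inj) (leqnn _)) _.
  rewrite -/(deg B1 z); have := grows_deg z gB1.
  have : 4 * b * (\sum_(j <- X) (4 * b < hit j)) <= \sum_(j <- X) hit j.
    rewrite big_distrr /=; apply: leq_sum => j _.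
    by case: ltnP => [/ltnW|_]; rewrite ?muln1 ?muln0.
  set H := \sum_(j <- X) (4 * b < hit j) => leH.
  have : 50 * H <= n + 800 * (b * b).
    by rewrite -(@leq_pmul2l (8 * b)) ?muln_gt0 //; lia.
  by have := leq_bb; lia.
move=> /eqP; rewrite addn_eq0 eqb0 -leqNgt => /andP[/eqP/joined0 zb hitj].
apply: (forces_claim _ zb); first by apply/edge_in_K/x_neq.
move=> A Ab.
(* At least 4b of the 8b chords at [g j] were free, and the last turn of Breaker takes at most [b]
   of them. *)
have [i iI] : exists2 i, i \in I & joined (A :|: B1) (f i) (g j) = 0.
  apply: seq_pick0.
  apply: leq_ltn_trans (_ : hit j + #|A| < _); last by rewrite szI; lia.
  apply: leq_trans (_ : \sum_(i <- I) (joined B1 (f i) (g j) + joined A (g j) (f i)) <= _).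
    by apply: leq_sum => i _; rewrite addnC [joined A _ _]joinedC joined_setU.
  rewrite big_split /= leq_add2l (leq_trans _ (deg_card A (g j))) //.
  exact: (sum_map_le (joined A (g j))).
move=> /joined0 fgb; have [ui _] := good _ iI.
apply: (forces_claim _ fgb); first by apply/edge_in_K/fg_neq => //; apply: IS.
move=> A' Ab'; apply: (fin _ _ i j) => //.
- by rewrite (subset_trans sM1) // setUA subsetUr.
(* The star takes 8b turns, the edge at [z] and the chord one each, and 8b + 2 <= 10b. *)
- apply: grows_leq (growsS (growsS gB1 Ab) Ab'); lia.
- exact: IS.
- by rewrite !setU1r.
- by rewrite setU1r // setU11.
- by rewrite setU11.
Qed.

End MiniGame.

(* The strategy lemmas are in continuation-passing style: it suffices to win from
   every position that the described moves can lead to. *)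
Lemma rotate_claim M B h t (avoid : 'I_n -> nat) :
    uniq (h :: t) -> size (h :: t) = n ->
    (deg B (last h t) + vsum avoid).+1 < n ->
    (forall p1 y p2 A, t = p1 ++ y :: p2 -> avoid y = 0 -> #|A| <= b ->
       forces ([set last h p1; last y p2] |: M) (A :|: B)) ->
  forces M B.
Proof.
move=> uht szt lt fin.
have [||p1 [y [p2 [et ax ay]]]] := @sum_path_lt_split n h t (joined B (last h t)) avoid.
- exact: uht.
- by move: lt; rewrite -[in X in _ < X]szt ltnS.
have neq : last h p1 != last y p2 by apply: uniq_last_neq; rewrite -et.
apply: (@forces_claim _ _ _ _ _ _ [set last h p1; last y p2]).
- exact: edge_in_K.
- by move/joined0: ax; rewrite et last_cat /= setUC.
- by move=> A Ab; apply: fin Ab.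
Qed.

(** Let [a] be the last vertex, a defect endpoint of largest Breaker degree. A 2-opt exchange puts a
    vertex [y] in its place; if the defect persists and no other was removed, a second exchange
    joins [y] to the tail [q] of another defect. In every case the endpoint weight drops by at least
    [g a]. *)
Lemma fast_round M B h t :
    uniq (h :: t) -> size (h :: t) = n -> [set last h t; h] \notin M ->
    16 * b < cycsum (defect M one) (h :: t) ->
    cycsum (defect M (fun v => deg B (last h t) < deg B v)) (h :: t) = 0 ->
    100 * deg B (last h t) <= n ->
    (forall M' B' c', M \subset M' -> grows 2 B B' -> uniq c' -> size c' = n ->
       (forall g, cycsum (defect M' g) c' + g (last h t) <= cycsum (defect M g) (h :: t)) ->
       forces M' B') ->
  forces M B.
Proof.
move=> uc sc bad; set D := cycsum (defect M one) _ => D_large exceed a_low fin.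
have bb := leq_bb.
(* Heavy vertices are joined by Breaker to more than an eighth of the [D] defect endpoints. These
   have degree at most that of the last vertex, so by averaging at most 8 times that degree many
   vertices are heavy. *)
pose heavy v : nat := D < 8 * cycsum (defect M (joined B v)) (h :: t).
have sum_heavy : vsum heavy <= 8 * deg B (last h t).
  rewrite -(@leq_pmul2l D); last by lia.
  apply: leq_trans (_ : 8 * cycsum (defect M (deg B)) (h :: t) <= _).
    rewrite -cycsum_defect_deg /vsum !big_distrr /=; apply: leq_sum => v _.
    by rewrite /heavy; case: ltnP => /=; lia.
  rewrite [leqRHS]mulnC -mulnA leq_mul2l /D -cycsum_scale /=.
  apply: leq_trans (leq_defect_cond (g' := fun v => deg B (last h t)) exceed _) _.
    by move=> v /eqP; rewrite eqb0 -leqNgt.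
  by apply: leq_cycsum => x y; rewrite /defect; lia.
apply: (@rotate_claim M B h t heavy) => //; first by lia.
move=> p1 y p2 A et /eqP; rewrite eqb0 -leqNgt => light Ab.
subst t; move: bad D_large exceed a_low fin; rewrite last_cat /=.
set a := last y p2; set x := last h p1; set M1 := _ |: M; set B1 := _ :|: B.
move=> bad D_large exceed a_low fin.
have sM1 : M \subset M1 by apply: subsetUr.
have xa1 : [set x; a] \in M1 by apply: setU11.
pose t1 := p1 ++ a :: rev (belast y p2).
have pc1 := perm_two_opt h p1 y p2; rewrite -/a -/t1 in pc1.
have uc1 : uniq (h :: t1) by rewrite -(perm_uniq pc1).
have sc1 : size (h :: t1) = n by rewrite -(perm_size pc1).
have opt1 g := two_opt g sM1 xa1; rewrite -/t1 -/a -/x in opt1.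
have last1 : last h t1 = y by rewrite last_cat /= last_rev_belast.
have gB1 : grows 1 B B1 by apply: growsS => //; apply: grows0.
(* One move is enough if the new closing arc is Maker's or the removed arc was itself a defect. *)
have [easy|] := boolP (([set y; h] \in M1) || ([set x; y] \notin M)).
  apply: (fin M1 B1 (h :: t1)) => //; first exact: grows_leq gB1.
  move=> g; have := opt1 g; rewrite (defect_notin _ bad).
  case/orP: easy => [yh|xy]; first by rewrite (defect0 _ yh); clear; lia.
  by rewrite (defect_notin _ xy); have := defect_le M1 g y h; clear; lia.
rewrite negb_or negbK => /andP[yh xy].
have ps g : pathsum (defect M1 g) h t1 + g a + g h = cycsum (defect M g) (h :: p1 ++ y :: p2).
  rewrite cycsum_cons !pathsum_cat /= last_cat /= -/x -/a (defect0 g xa1).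
  rewrite (pathsum_rev _ _ (defectC M1 g)) (defect0 g xy) (defect_notin g bad).
  have ->: pathsum (defect M1 g) h p1 = pathsum (defect M g) h p1.
    apply: pathsum_claim; move: uc; rewrite -cat_cons cat_uniq => /and3P[_ /hasPn dis _].
    by have := dis _ (mem_last y p2).
  have ->: pathsum (defect M1 g) y p2 = pathsum (defect M g) y p2.
    rewrite /M1 setUC [[set x; a]]setUC setUC; apply: pathsum_claim.
    move: uc; rewrite -cat_cons cat_uniq => /and3P[_ /hasPn dis _].
    by apply/negP => /dis; rewrite /= mem_last.
  by clear; lia.
(* The factor 2 matches the weight of a defect under [one], so strictness yields a defect whose tail
   Breaker has not joined to [y]. It holds since [y] is light, the last turn adds at most [b] edges,
   and D > 16b. *)
have : pathsum (fun q q' => 2 * (([set q; q'] \notin M1) * joined B1 y q)) h t1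
      < pathsum (defect M1 one) h t1.
  have := ps one; rewrite -/D => psD.
  have := ps (joined B y) => psy.
  apply: leq_ltn_trans (_ : 2 * (pathsum (defect M1 (joined B y)) h t1 + b) < _); last by lia.
  rewrite pathsum_scale leq_mul2l /=.
  apply: leq_trans (_ : pathsum (fun q q' => defect M1 (joined B y) q q' + (joined A y q + 0)) h t1 <= _).
    apply: leq_pathsum => q q'; rewrite /defect addn0; case: (_ \in M1) => //=.
    by rewrite !mul1n; have := joined_setU A B y q; rewrite -/B1; clear; lia.
  rewrite pathsum_add leq_add2l (pathsum_vertex _ (fun=> 0)) [X in _ + X]big1 // addn0.
  apply: leq_trans (sum_uniq_le (joined A y) _) _; last exact: leq_trans (deg_card A y) Ab.
  by move: uc1; rewrite lastI rcons_uniq => /andP[].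
move=> ltp; have [r1 [q' [r2 [et1]]]] := pathsum_lt_split ltp; set q := last h r1 => ltq.
have qq' : [set q; q'] \notin M1 by apply: (defect_gt0 (g := one)); apply: leq_ltn_trans ltq.
move: ltq; rewrite (defect_notin _ qq') qq' mul1n => ltq.
have jq : joined B1 y q = 0 by move: ltq; clear; lia.
have last2 : last q' r2 = y by rewrite -last1 et1 last_cat.
have neq : q != y by rewrite -last2; apply: uniq_last_neq; rewrite -et1.
apply: (@forces_claim _ _ _ _ _ _ [set q; y]); first exact: edge_in_K.
  by rewrite setUC joined0.
move=> A2 A2b; set M2 := _ |: M1.
have sM2 : M1 \subset M2 by apply: subsetUr.
have qy2 : [set q; last q' r2] \in M2 by rewrite last2 setU11.
have pc2 := perm_two_opt h r1 q' r2.
apply: (fin M2 _ (h :: r1 ++ last q' r2 :: rev (belast q' r2))).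
- exact: subset_trans sM2.
- exact: growsS.
- by rewrite -(perm_uniq pc2) -et1.
- by rewrite -(perm_size pc2) -et1.
move=> g; have := two_opt g sM2 qy2; rewrite -/q -et1 last2.
have := opt1 g; rewrite (defect_notin _ bad) (defect_notin _ yh) (defect_notin _ qq').
have := defect_le M2 g q' h.
set C2 := cycsum (defect M2 g) _; set C1 := cycsum (defect M1 g) _.
by set C0 := cycsum (defect M g) _; clear; lia.
Qed.

(** A defect endpoint of degree d contributes d^2 to the sum, and 300^2 * 164 < 4000^2. *)
Lemma endpoint_deg M B c h t :
    cycsum (defect M (sqdeg B)) c <= 164 * (b * b * n) ->
    same_cycle c (h :: t) -> [set last h t; h] \notin M ->
  300 * deg B (last h t) <= n.
Proof.
move=> pot ch bad; move: pot; rewrite (same_cycle_defect _ _ ch) cycsum_cons.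
rewrite (defect_notin _ bad); set d := deg B _ => pot.
have nn : 4000 * (4000 * (b * b)) * n <= n * n by rewrite leq_mul2r b_small orbT.
rewrite -leq_sqr -!mulnn mulnACA.
move: pot nn; set q := b * b * n; set r := pathsum _ _ _; set r' := deg B h * _.
have -> : 4000 * (4000 * (b * b)) * n = 4000 * (4000 * q) by rewrite /q -!mulnA.
set dd := d * d; set m := n * n.
by clearbody q r r' dd m; clear; lia.
Qed.

(* The drop m^2 pays for the linear term: 16 m b <= m^2 + 64 b^2. *)
Lemma potential_step M B B' c m k : grows 2 B B' -> uniq c ->
    cycsum (defect M (fun v => m < deg B v)) c = 0 ->
    cycsum (defect M (sqdeg B)) c + m * m <= k ->
  cycsum (defect M (sqdeg B')) c <= k + 80 * (b * b).
Proof.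
move=> [A Ab ->] uc exceed le_k.
(* From (d + i)^2 = d^2 + (2d + i) i with d <= m and i <= 2b. *)
pose K := 2 * m + 2 * b.
apply: leq_trans (leq_defect_cond (g' := fun v => deg B v * deg B v + K * deg A v) exceed _) _.
  move=> v /eqP; rewrite eqb0 -leqNgt => vm.
  have iA := leq_trans (deg_card A v) Ab; have dv := deg_setU A B v.
  apply: leq_trans (leq_mul dv dv) _; move: iA vm; rewrite /K.
  set i := deg A v; set d := deg B v; clearbody i d; clear; nia.
have -> : cycsum (defect M (fun v => deg B v * deg B v + K * deg A v)) c =
    cycsum (defect M (sqdeg B)) c + cycsum (defect M (fun v => K * deg A v)) c.
  rewrite -cycsum_add; apply/eqP; rewrite eqn_leq.
  by apply/andP; split; apply: leq_cycsum => x y; rewrite defect_add.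
have : cycsum (defect M (fun v => K * deg A v)) c <= K * (8 * b).
  apply: leq_trans (_ : cycsum (fun x y => K * (deg A x + deg A y)) c <= _).
    by apply: leq_cycsum => x y; rewrite mulnDr defect_le.
  rewrite cycsum_scale leq_mul2l cycsum_vertex; apply/orP; right.
  have := leq_trans (sum_uniq_le (deg A) uc) (sum_deg A).
  by move: Ab; clear; lia.
move: le_k; set C := cycsum (defect M (sqdeg B)) c.
set C' := cycsum _ _; rewrite /K.
by have := (nat_Cauchy m (8 * b)).1; rewrite -!mulnn; clearbody C C'; clear; lia.
Qed.

(** Both budgets prepay the remaining rounds: per unit of defect weight, 80b^2 for the squared
    degrees and 2b for Breaker's edges. The initial weight is at most 2n, which gives 164 = 4 + 160
    and 5 = 1 + 4. *)
Lemma fast_phase M B c : uniq c -> size c = n ->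
    cycsum (defect M (sqdeg B)) c + 80 * (b * b * cycsum (defect M one) c)
      <= 164 * (b * b * n) ->
    #|B| + 2 * (b * cycsum (defect M one) c) <= 5 * (b * n) ->
    (forall M' B' c', uniq c' -> size c' = n -> cycsum (defect M' one) c' <= 16 * b ->
       cycsum (defect M' (highdeg 300 B')) c' = 0 -> #|B'| <= 5 * (b * n) ->
       forces M' B') ->
  forces M B.
Proof.
have [k] := ubnP (cycsum (defect M one) c).
elim: k M B c => // k IH M B c; rewrite ltnS => Dk uc sc pot Bn fin.
have pot' := leq_trans (leq_addr _ _) pot.
have [D_small|D_large] := leqP (cycsum (defect M one) c) (16 * b).
  apply: (fin M B c) => //; last exact: leq_trans (leq_addr _ _) Bn.
  apply/eqP; rewrite -leqn0 leqNgt; apply/negP => /defect_arc[h [t [ch bad]]].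
  by rewrite lt0b ltnNge (endpoint_deg pot' ch bad).
have [h [t [ch bad exceed]]] := max_endpoint (deg B) (leq_ltn_trans (leq0n _) D_large).
have [uht sht] := same_cycle_spanning ch uc sc.
have eC M' g : cycsum (defect M' g) c = cycsum (defect M' g) (h :: t).
  exact: same_cycle_defect.
have a_low := endpoint_deg pot' ch bad.
move: Dk pot Bn D_large exceed; rewrite !eC => Dk pot Bn D_large exceed.
apply: (fast_round (B := B) uht sht bad) => //.
  by move: a_low; clear; lia.
move=> M' B' c' sM gB uc' sc' dec.
have dec1 := dec one.
apply: (IH M' B' c') => //.
- by move: dec1 Dk; clear; lia.
(* Applied to an indicator weight, [dec] shows that the new defect endpoints still have degree in
   [B] at most the former maximum. *)
- have exceed' : cycsum (defect M' (fun v => deg B (last h t) < deg B v)) c' = 0.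
    apply/eqP; rewrite -leqn0 -exceed; apply: leq_trans (dec _).
    exact: leq_addr.
  have := potential_step gB uc' exceed' (dec (sqdeg B)).
  move: pot dec1; set C := cycsum (defect M one) _; set C' := cycsum (defect M' one) _.
  set P := cycsum (defect M _) _; set P' := cycsum (defect M' _) _.
  clearbody C C' P P'; set q := b * b; set r := q * n => pot dec1.
  have : q * C' + q <= q * C by rewrite addnC -mulnS leq_mul2l -addn1 dec1 orbT.
  by move: pot; clear; lia.
- have := grows_card gB; move: Bn dec1.
  set C := cycsum (defect M one) _; set C' := cycsum (defect M' one) _.
  clearbody C C' => Bn dec1.
  have : b * C' + b <= b * C by rewrite addnC -mulnS leq_mul2l -addn1 dec1 orbT.
  by move: Bn; clear; lia.
Qed.

(** * Slow phase: the last defects *)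

Lemma card_budget B : #|B| <= 16 * (b * b * n) -> 100 * (200 * #|B|) <= n * n.
Proof.
have nn : 4000 * (4000 * (b * b)) * n <= n * n by rewrite leq_mul2r b_small orbT.
move: nn; set q := b * b * n; set m := n * n.
have -> : 4000 * (4000 * (b * b)) * n = 4000 * (4000 * q) by rewrite /q -!mulnA.
by set k := #|B|; clearbody q m k; clear; lia.
Qed.

(** Mini-game with centres at both ends of the path, where [f] is the predecessor and [g] the
    successor map. Taking [i] from the first half and [j] from the second makes the three claimed
    edges those of a 3-opt exchange. *)
Lemma close_path M B h t : uniq (h :: t) -> n <= 2 * size (h :: t) ->
    100 * deg B h <= n -> 100 * deg B (last h t) <= n ->
    100 * (200 * #|B|) <= n * n ->
    (forall M' B' p1 s p2 y p3, M \subset M' -> grows (10 * b) B B' ->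
       t = p1 ++ s :: p2 ++ y :: p3 -> [set h; s] \in M' ->
       [set last h p1; y] \in M' -> [set last y p3; last s p2] \in M' ->
       forces M' B') ->
  forces M B.
Proof.
move=> up nl h_low z_low Bs fin; set l := size (h :: t) in nl.
have bb := leq_bb.
have l_large : 100 <= l by move: nl bb b_small b_gt0; clear; lia.
have nthE i j : i < l -> j < l -> (nth h (h :: t) i == nth h (h :: t) j) = (i == j).
  by move=> il jl; rewrite nth_uniq.
have zE : last h t = nth h (h :: t) l.-1 by rewrite (last_nth h).
pose m := l./2.
have mE : 2 * m <= l <= 2 * m + 1 by rewrite /m; clear; lia.
(* Position 0 is left out of the first range for the predecessor to exist, and l - 1 out of the
   second for the successor. *)
apply: (@mini_game M B h (last h t) (iota 1 (m - 1)) (iota m (l - 1 - m))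
  (nth h (h :: t)) (fun i => nth h (h :: t) i.-1)
  (nth h (h :: t)) (fun j => nth h (h :: t) j.+1)) => //; rewrite ?iota_uniq ?size_iota //.
- move=> i j; rewrite !mem_iota => hi hj /eqP.
  by rewrite nthE; [move/eqP|move: hi hj mE; clear; lia..].
- move=> i j; rewrite !mem_iota => hi hj /eqP.
  by rewrite nthE; [move: hi hj; clear; lia|move: hi hj mE; clear; lia..].
- move=> i j; rewrite !mem_iota => hi hj /eqP.
  by rewrite nthE; [move/eqP|move: hi hj mE l_large; clear; lia..].
- move=> i j; rewrite !mem_iota => hi hj /eqP.
  by rewrite nthE; [move/eqP => []|move: hi hj mE l_large; clear; lia..].
- by move: nl l_large mE; clear; lia.
- by move: nl l_large mE; clear; lia.
- move=> i; rewrite mem_iota => hi; rewrite -[X in X != _]/(nth h (h :: t) 0).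
  by rewrite nthE; move: hi mE l_large; clear; lia.
- move=> j; rewrite mem_iota zE => hj.
  by rewrite nthE; move: hj mE l_large; clear; lia.
- move=> i j; rewrite !mem_iota => hi hj.
  by rewrite nthE; move: hi hj mE l_large; clear; lia.
move=> M' B' i j sM gB; rewrite !mem_iota => hi hj us zx fg.
have [||| p1 [s [p2 [y [p3 [et es ep1 ep2 ey]]]]]] := @seq_split3 _ h t i j.
- by move: hi; clear; lia.
- by move: hi hj; clear; lia.
- by move: hj l_large mE; rewrite /l /=; clear; lia.
apply: (fin M' B' p1 s p2 y p3) => //.
- by rewrite es.
- by rewrite ep1 ey.
- by rewrite ep2; move: zx; rewrite et last_cat /= last_cat.
Qed.

Lemma grows_deg_ge k B B' v : grows k B B' -> deg B v <= deg B' v.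
Proof.
move=> [A _ ->]; apply: leq_sum => w _; rewrite /joined !inE.
by case: (_ \in B); rewrite ?orbT.
Qed.

(* B1 is the graph of Breaker when the phase starts: measuring degrees in B1
   keeps the set of endpoints to exchange from growing during the phase. *)
Lemma refresh_phase k j d M B B1 B' c :
    uniq c -> size c = n -> cycsum (defect M (highdeg 300 B1)) c <= k ->
    cycsum (defect M one) c <= d -> cycsum (defect M (highdeg 200 B)) c = 0 ->
    100 * (200 * #|B1|) <= n * n -> grows (10 * b) B B1 -> grows j B1 B' ->
    j + k <= 16 * b ->
    (forall M' B' c', uniq c' -> size c' = n -> cycsum (defect M' one) c' <= d ->
       cycsum (defect M' (highdeg 300 B1)) c' = 0 -> grows (16 * b) B1 B' ->
       forces M' B') ->
  forces M B'.
Proof.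
have bb := leq_bb.
move=> uc sc dk Dd low Bs gB gB' jk fin.
elim: k j M B' c uc sc dk Dd low gB' jk => [|k IH] j M B' c uc sc dk Dd low gB' jk.
  apply: (fin M B' c) => //; first by apply/eqP; rewrite -leqn0.
  by apply: grows_leq gB'; move: jk; clear; lia.
have [dirty0|] := posnP (cycsum (defect M (highdeg 300 B1)) c).
  by apply: (fin M B' c) => //; apply: grows_leq gB'; move: jk; clear; lia.
move=> /defect_arc[h [t [ch bad dirty]]].
have [uht sht] := same_cycle_spanning ch uc sc.
have eC M' g : cycsum (defect M' g) c = cycsum (defect M' g) (h :: t).
  exact: same_cycle_defect.
move: dk Dd low; rewrite !eC => dk Dd low.
have [/highdeg0 a_low _] := defect_zero_closing low bad.
apply: (@rotate_claim M B' h t (highdeg 300 B1)) => //.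
  have := few_highdeg 300 B1; have := grows_deg (last h t) gB; have := grows_deg (last h t) gB'.
  have jb : j * b <= 16 * (b * b) by rewrite mulnA leq_mul2r; move: jk; clear; lia.
  move: Bs a_low jb b_small bb b_gt0.
  set k1 := #|B1|; set s1 := vsum _; set da := deg B' _; set da1 := deg B1 _; set da0 := deg B _.
  set jbb := j * b; rewrite -mulnA; set q := b * b; clearbody q k1 s1 da da1 da0 jbb; clear.
  move=> Bs a_low jb qn bq b0 d1 d2 few.
  (* By Markov n s1 <= 600 |B1|, while 20000 |B1| <= n^2. *)
  have s1n : 100 * s1 <= 3 * n.
    rewrite -(@leq_pmul2l n); last by lia.
    by rewrite !(mulnCA n); lia.
  by lia.
move=> p1 y p2 A et /highdeg0 y_low Ab.
subst t; move: bad dirty; rewrite last_cat /=.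
set a := last y p2; set x := last h p1; set M1 := _ |: M => bad dirty.
have sM1 : M \subset M1 by apply: subsetUr.
have xa1 : [set x; a] \in M1 by apply: setU11.
have pc1 := perm_two_opt h p1 y p2.
have dec g : cycsum (defect M1 g) (h :: p1 ++ a :: rev (belast y p2)) + g a <=
    cycsum (defect M g) (h :: p1 ++ y :: p2) + g y.
  have := two_opt g sM1 xa1; rewrite -/a -/x (defect_notin _ bad).
  have := defect_le M1 g y h.
  set C1 := cycsum (defect M1 g) _; set C0 := cycsum (defect M g) _.
  by clear; lia.
apply: (IH j.+1 M1 _ (h :: p1 ++ a :: rev (belast y p2))).
- by rewrite -(perm_uniq pc1).
- by rewrite -(perm_size pc1).
- have := dec (highdeg 300 B1); have /highdeg0-> := y_low.
  move: dirty dk; set C1 := cycsum (defect M1 _) _; set C0 := cycsum (defect M _) _.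
  by clear; lia.
- by have := dec one; rewrite leq_add2r => /leq_trans; apply.
- have := dec (highdeg 200 B); rewrite low.
  have -> : highdeg 200 B y = 0.
    by apply/highdeg0; have := grows_deg_ge y gB; move: y_low; clear; lia.
  by rewrite addn0 leqn0 addn_eq0 => /andP[/eqP].
- exact: growsS.
- by rewrite addSnnS.
Qed.

(** A round takes at most 10b turns for the mini-game and 16b for refreshing the endpoints, hence at
    most 26b^2 Breaker edges. Refreshed endpoints have degree at most n/300, and the turns of the
    refresh leave them within n/200. *)
Lemma slow_phase d M B c : uniq c -> size c = n ->
    cycsum (defect M one) c <= d -> d <= 16 * b ->
    cycsum (defect M (highdeg 200 B)) c = 0 ->
    #|B| + 26 * (b * b * d) <= 6 * (b * b * n) ->
    (forall M' B' c', uniq c' -> size c' = n -> cycsum (defect M' one) c' = 0 ->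
       #|B'| <= 6 * (b * b * n) -> forces M' B') ->
  forces M B.
Proof.
move=> uc sc Dd db low Bn fin.
elim: d M B c uc sc Dd db low Bn => [|d IH] M B c uc sc Dd db low Bn.
  apply: (fin M B c) => //; first by apply/eqP; rewrite -leqn0.
  exact: leq_trans (leq_addr _ _) Bn.
have [D0|] := posnP (cycsum (defect M one) c).
  by apply: (fin M B c) => //; apply: leq_trans (leq_addr _ _) Bn.
move=> /defect_arc[h [t [ch bad _]]].
have [uht sht] := same_cycle_spanning ch uc sc.
have eC M' g : cycsum (defect M' g) c = cycsum (defect M' g) (h :: t).
  exact: same_cycle_defect.
move: Dd low; rewrite !eC => Dd low.
have [/highdeg0 a_low /highdeg0 h_low] := defect_zero_closing low bad.
have bb := leq_bb.
have bound (e : nat) : e <= 10 * (b * b) -> #|B| + e <= 16 * (b * b * n).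
  have : b * b <= b * b * n by rewrite leq_pmulr //; move: b_small bb b_gt0; clear; lia.
  by move: Bn; clear; lia.
apply: (@close_path M B h t) => //.
- by rewrite sht; clear; lia.
- by move: h_low; clear; lia.
- by move: a_low; clear; lia.
- by apply: card_budget; have := bound 0 (leq0n _); rewrite addn0.
move=> M1 B1 p1 s p2 y p3 sM1 gB1 et hs xy zx.
pose c1 := h :: p1 ++ y :: p3 ++ last s p2 :: rev (belast s p2).
have pc1 : perm_eq (h :: t) c1 by rewrite et perm_three_opt.
have uc1 : uniq c1 by rewrite -(perm_uniq pc1).
have sc1 : size c1 = n by rewrite -(perm_size pc1).
have elast : last h t = last y p3 by rewrite et last_cat /= last_cat.
have dec g : cycsum (defect M1 g) c1 + g (last h t) + g h <= cycsum (defect M g) (h :: t).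
  rewrite -addnA -(defect_notin g bad) elast et.
  exact: three_opt.
have B1c : #|B1| <= #|B| + 10 * (b * b) by have := grows_card gB1; rewrite -mulnA.
have D1 : cycsum (defect M1 one) c1 <= d.
  have := dec one; move: Dd; set C1 := cycsum (defect M1 _) _; set C0 := cycsum (defect M _) _.
  by clear; lia.
(* Defect endpoints, counted with multiplicity, number at most d <= 16b, so that many exchanges
   suffice. *)
apply: (@refresh_phase (16 * b) 0 d M1 B B1 B1 c1) => //.
- apply: leq_trans (leq_defect _ _ (g' := one) _) _; last by move: D1 db; clear; lia.
  by move=> v; apply: leq_b1.
- by have := dec (highdeg 200 B); rewrite low leqn0 !addn_eq0 => /andP[/andP[/eqP]].
- by apply: card_budget; apply: leq_trans B1c _; apply: bound.
- exact: grows0.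
move=> M2 B2 c2 uc2 sc2 D2 low2 gB2.
apply: (IH M2 B2 c2) => //.
- exact: ltnW.
- apply: defect_zero_imp low2 _ => v /highdeg0 v_low; apply/highdeg0.
  by have := grows_deg v gB2; move: v_low b_small; rewrite -mulnA; clear; lia.
have := grows_card gB2; rewrite -mulnA; move: Bn B1c.
set k := #|B|; set k1 := #|B1|; set k2 := #|B2|; rewrite mulnS.
by clear; lia.
Qed.

End Strategy.

(** * Pancyclicity *)

Section Pancyclicity.
Variables (n b : nat).
Hypotheses (b_gt0 : 0 < b) (b_small : 4000 * (4000 * (b * b)) <= n).
Implicit Types (x y h u v w z : 'I_n) (p t c : seq 'I_n).
Implicit Types (A B M : {set {set 'I_n}}) (g : 'I_n -> nat).

Local Notation forces := (forces (edges_K n) b (@pancyclic n)).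
Local Notation one := (fun _ : 'I_n => 1).

Definition has_cycle M l := exists c, ucycle (adj M) c /\ size c = l.

Lemma has_cycle_sub M M' l : M \subset M' -> has_cycle M l -> has_cycle M' l.
Proof.
move=> sM [c [/andP[cyc uc] sc]]; exists c; split=> //; rewrite /ucycle uc andbT.
by apply: sub_cycle cyc => x y; apply: (subsetP sM).
Qed.

Lemma pathsum0_path M x s : pathsum (defect M one) x s = 0 -> path (adj M) x s.
Proof.
elim: s x => //= y s IH x /eqP; rewrite addn_eq0 => /andP[/eqP xy /eqP/IH->].
by rewrite andbT; move: xy; rewrite /defect /adj; case: (_ \in M).
Qed.

Lemma cycsum0_cycle M c : cycsum (defect M one) c = 0 -> cycle (adj M) c.
Proof. by case: c => // x s; apply: pathsum0_path. Qed.

Lemma n_large : 4000 < n.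
Proof. by move: (leq_bb b_gt0) b_small b_gt0; clear; lia. Qed.

(** Averaging over the rotations of the Hamilton cycle gives a segment of [l] vertices with both
    ends of low Breaker degree; [close_path] then turns it into a cycle on the same vertices. *)
Lemma long_cycle M B c l : uniq c -> size c = n -> cycsum (defect M one) c = 0 ->
    n <= 2 * l -> l <= n -> 100 * (200 * #|B|) <= n * n ->
    (forall M' B', M \subset M' -> grows b (10 * b) B B' -> has_cycle M' l ->
       forces M' B') ->
  forces M B.
Proof.
move=> uc sc cyc0 nl ln Bs fin; have nL := n_large.
have [d _] : exists d, d \in c.
  by case: c sc {uc cyc0} => [|x c] sc; [move: nL; rewrite -sc|exists x; rewrite mem_head].
have few := few_highdeg100 b_gt0 b_small Bs.
have rot_inj j : j < n -> {in iota 0 n &, injective (fun k => nth d (rot k c) j)}.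
  move=> jn k k'; rewrite !mem_iota /= !add0n => kn kn'; rewrite !(@nth_rotC _ d c j) ?sc // => /eqP.
  by rewrite nth_uniq ?rot_uniq ?size_rot ?sc // => /eqP.
have [k] : exists2 k, k \in iota 0 n &
    highdeg 100 B (nth d (rot k c) 0) + highdeg 100 B (nth d (rot k c) l.-1) = 0.
  apply: seq_pick0; rewrite big_split /= size_iota.
  have i0 : 0 < n by apply: leq_trans nL.
  have il : l.-1 < n by move: nl ln nL; clear; lia.
  apply: leq_ltn_trans (leq_add
     (sum_map_le (highdeg 100 B) (iota_uniq 0 n) (rot_inj _ i0))
     (sum_map_le (highdeg 100 B) (iota_uniq 0 n) (rot_inj _ il))) _.
  by move: few nL; clear; lia.
rewrite mem_iota /= add0n => kn /eqP; rewrite addn_eq0 => /andP[/eqP/highdeg0 h_low /eqP/highdeg0 z_low].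
have srot : same_cycle c (rot k c).
  by rewrite /rot -{1}(cat_take_drop k c); apply: same_cycle_rot.
move: h_low z_low; have szr : size (rot k c) = n by rewrite size_rot.
have urot : uniq (rot k c) by rewrite rot_uniq.
move: cyc0; rewrite (same_cycle_defect _ _ srot).
case erot : (rot k c) szr urot => [|h r] szr urot cyc0 h_low z_low.
  by exfalso; move: nL; rewrite -szr.
have lE : l = (l.-1).+1 by move: nl nL; clear; lia.
have lr : l.-1 <= size r by move: szr ln lE => /=; clear; lia.
pose t := take l.-1 r.
have szt : size (h :: t) = l by rewrite /= size_takel // -lE.
have ut : uniq (h :: t).
  by have := take_uniq l urot; rewrite lE.
have elast : last h t = nth d (h :: r) l.-1.
  rewrite (last_nth d) size_takel //.
  have -> : h :: t = take l (h :: r) by rewrite [in RHS]lE.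
  by rewrite nth_take // [X in _ < X]lE.
have pt0 : pathsum (defect M one) h t = 0.
  move: cyc0; rewrite cycsum_cons -[r in pathsum _ _ r](cat_take_drop l.-1) pathsum_cat -/t.
  by move=> /eqP; rewrite !addn_eq0 => /andP[/andP[/eqP]].
apply: (@close_path n b _ b_gt0 b_small M B h t) => //; first by rewrite szt.
  by rewrite elast.
move=> M' B' p1 s p2 y p3 sM gB et hs xy zx.
apply: (fin M' B') => //.
have := three_opt one sM hs xy zx.
have elast' : last h t = last y p3 by rewrite et last_cat /= last_cat.
rewrite -et [leqRHS]cycsum_cons pt0 add0n elast' -[leqRHS]add0n leq_add2r leqn0 => /eqP c0.
have pc := perm_three_opt h p1 s p2 y p3; rewrite -et in pc.
exists (h :: p1 ++ y :: p3 ++ last s p2 :: rev (belast s p2)).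
by rewrite /ucycle cycsum0_cycle // -(perm_uniq pc) -(perm_size pc).
Qed.

(** The cycle runs from [u] through the m + 1 consecutive vertices from position [i] to i + m, then
    to a further vertex at position [j], and back to [u], which is the centre of both stars. *)
Lemma short_cycle M B c m : uniq c -> size c = n -> cycsum (defect M one) c = 0 ->
    2 * m <= n -> 100 * (200 * #|B|) <= n * n ->
    (forall M' B', M \subset M' -> grows b (10 * b) B B' -> has_cycle M' m.+3 ->
       forces M' B') ->
  forces M B.
Proof.
move=> uc sc cyc0 mn Bs fin; have nL := n_large.
have [d _] : exists d, d \in c.
  by case: c sc {uc cyc0} => [|x c] sc; [move: nL; rewrite -sc|exists x; rewrite mem_head].
have few := few_highdeg100 b_gt0 b_small Bs.
(* Segments start within [0, q] and, as m <= n/2, end before 5q + 4; the further vertex lies in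
   [5q + 4, 6q + 4] and [u] in [6q + 5, 7q + 5], so all are distinct. *)
pose q := n %/ 8; have qE : 8 * q <= n < 8 * q + 8 by rewrite /q; clear; lia.
have nthE i j : i < n -> j < n -> (nth d c i == nth d c j) = (i == j).
  by move=> il jl; rewrite nth_uniq ?sc.
have nth_inj a : a + q.+1 <= n -> {in iota a q.+1 &, injective (nth d c)}.
  move=> an i j; rewrite !mem_iota => hi hj /eqP.
  by rewrite nthE; [move/eqP|move: hi hj an; clear; lia..].
have [k] : exists2 k, k \in iota (6 * q + 5) q.+1 & highdeg 100 B (nth d c k) = 0.
  apply: seq_pick0; rewrite size_iota.
  apply: leq_ltn_trans (sum_map_le (highdeg 100 B) (iota_uniq _ _) (nth_inj _ _)) _.
    by move: qE nL; clear; lia.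
  by move: few qE; clear; lia.
rewrite mem_iota => hk /highdeg0 u_low; set u := nth d c k in u_low.
apply: (@mini_game n b _ b_gt0 b_small M B u u (iota 0 q.+1) (iota (5 * q + 4) q.+1)
  (nth d c) (fun i => nth d c (i + m)) (nth d c) (nth d c)) => //;
  rewrite ?iota_uniq ?size_iota //; try by move: qE; clear; lia.
- by apply: nth_inj; move: qE nL; clear; lia.
- move=> i j; rewrite !mem_iota => hi hj /eqP.
  by rewrite nthE; [rewrite eqn_add2r => /eqP|move: hi hj qE mn nL; clear; lia..].
- by apply: nth_inj; move: qE nL; clear; lia.
- by apply: nth_inj; move: qE nL; clear; lia.
- move=> i; rewrite mem_iota => hi.
  by rewrite nthE; move: hi hk qE nL; clear; lia.
- move=> i; rewrite mem_iota => hi.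
  by rewrite nthE; move: hi hk qE nL; clear; lia.
- move=> i j; rewrite !mem_iota => hi hj.
  by rewrite nthE; move: hi hj hk qE nL mn; clear; lia.
move=> M' B' i j sM gB; rewrite !mem_iota => hi hj us ux fx.
apply: (fin M' B') => //.
have im : i + m < n by move: hi qE nL mn; clear; lia.
pose seg := take m.+1 (drop i c).
have szseg : size seg = m.+1.
  by rewrite size_takel // size_drop sc; move: im; clear; lia.
have seg_notin r : i + m < r < n -> nth d c r \notin seg.
  move=> hr; apply/negP => /(nthP d)[r' r'm]; rewrite szseg in r'm.
  rewrite nth_take // nth_drop => /eqP; rewrite nthE; move: hr r'm im; clear; lia.
have seg_path : sorted (adj M') seg.
  apply/take_sorted/drop_sorted.
  have := cycsum0_cycle cyc0; case: (c) => //= x s; rewrite rcons_path => /andP[ps _].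
  by apply: sub_path ps => ? ?; apply: (subsetP sM).
have seg_head : nth d seg 0 = nth d c i by rewrite nth_take // nth_drop addn0.
have seg_last : last d seg = nth d c (i + m) by rewrite (last_nth d) szseg /= nth_take // nth_drop.
have useg : uniq seg by rewrite take_uniq // drop_uniq.
have u_seg : u \notin seg by apply: seg_notin; move: hi hk qE nL mn; clear; lia.
have x_seg : nth d c j \notin seg by apply: seg_notin; move: hi hj qE nL mn; clear; lia.
have ux_neq : u != nth d c j by rewrite nthE; move: hj hk qE nL; clear; lia.
exists (u :: rcons seg (nth d c j)); split; last by rewrite /= size_rcons szseg.
rewrite /ucycle /= mem_rcons inE negb_or ux_neq u_seg rcons_uniq x_seg useg !andbT.
move: seg_head seg_last seg_path szseg; case: (seg) => // s0 seg' /= -> seg_last seg_path _.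
rewrite !rcons_path last_rcons seg_path seg_last /adj us fx /=.
by rewrite setUC.
Qed.

(** Lengths up to n - r are done. Maker keeps his edges, so the Hamilton cycle stays available, and
    each length costs at most 10b turns, prepaid as 10b^2 Breaker edges. *)
Lemma all_lengths r M B c : uniq c -> size c = n -> cycsum (defect M one) c = 0 ->
    #|B| + 10 * (b * b * r) <= 16 * (b * b * n) ->
    (forall l, 2 < l -> l + r <= n -> has_cycle M l) ->
  forces M B.
Proof.
move=> uc sc cyc0; elim: r M B cyc0 => [|r IH] M B cyc0 Bn done_lengths.
  by apply: forces_done => l /andP[l3 ln]; apply: done_lengths; rewrite ?addn0.
have Bs : 100 * (200 * #|B|) <= n * n.
  by apply: (card_budget b_small); apply: leq_trans (leq_addr _ _) Bn.
have next M' B' : M \subset M' -> grows b (10 * b) B B' ->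
    (2 < n - r -> has_cycle M' (n - r)) -> forces M' B'.
  move=> sM gB new; apply: IH.
  - by have := cycsum_defect_sub one c sM; rewrite cyc0 leqn0 => /eqP.
  - have := grows_card gB; rewrite -mulnA; move: Bn; rewrite mulnS.
    set k := #|B|; set k' := #|B'|; by clear; lia.
  move=> l l3 ln; have [lt|ge] := ltnP (l + r) n.
    by apply: has_cycle_sub sM _; apply: done_lengths; rewrite // addnS.
  have el : l = n - r by move: ln ge; clear; lia.
  by rewrite el; apply: new; rewrite -el.
have [small|large] := leqP (n - r) 2.
  apply: (next M B) => //; last by rewrite ltnNge small.
  by apply: grows_leq (grows0 _ _); rewrite leq0n.
have [short|long] := leqP (2 * (n - r - 3)) n.
  apply: (@short_cycle M B c (n - r - 3)) => // M' B' sM gB.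
  by rewrite (_ : (n - r - 3).+3 = n - r) => [cy|]; [apply: next|move: large; clear; lia].
apply: (@long_cycle M B c (n - r)) => //; try by move: long; clear; lia.
by move=> M' B' sM gB cy; apply: next.
Qed.

Lemma forces_pancyclic B : #|B| <= b -> forces set0 B.
Proof.
move=> Bb; have nL := n_large; have bb := leq_bb b_gt0.
have sz : size (enum 'I_n) = n by rewrite size_enum_ord.
have vtx M g c : cycsum (defect M g) c <= 2 * (\sum_(x <- c) g x).
  by rewrite -cycsum_vertex; apply: leq_cycsum => x y; apply: defect_le.
have D0 : cycsum (defect set0 one) (enum 'I_n) <= 2 * n.
  by apply: leq_trans (vtx _ _ _) _; rewrite sum1_size sz.
(* Each degree is at most [b] and the degrees sum to at most 2b; every vertex lies on two arcs. *)
have P0 : cycsum (defect set0 (fun v => deg B v * deg B v)) (enum 'I_n) <= 4 * (b * b).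
  apply: leq_trans (vtx _ _ _) _.
  apply: leq_trans (_ : 2 * (\sum_(x <- enum 'I_n) b * deg B x) <= _).
    rewrite leq_mul2l /=; apply: leq_sum => x _; rewrite leq_mul2r.
    by rewrite (leq_trans (deg_card B x) Bb) orbT.
  rewrite -big_distrr /=; have := leq_trans (sum_uniq_le (deg B) (enum_uniq 'I_n)) (sum_deg B).
  move=> /leq_trans /(_ (leq_mul (leqnn 2) Bb)).
  set s := \sum_(v <- _) _ => sb.
  have : b * s <= b * (2 * b) by rewrite leq_mul2l sb orbT.
  by clear; lia.
apply: (@fast_phase n b _ b_gt0 b_small set0 B (enum 'I_n)) => //.
- exact: enum_uniq.
- set C := cycsum (defect set0 one) _ in D0 *.
  have : b * b * C <= b * b * (2 * n) by rewrite leq_mul2l D0 orbT.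
  have : b * b <= b * b * n by rewrite leq_pmulr //; move: nL; clear; lia.
  move: P0; set P := cycsum _ _; rewrite (mulnCA (b * b) 2); set q := b * b; set r := q * n.
  by clear; lia.
- set C := cycsum (defect set0 one) _ in D0 *.
  have : b * C <= b * (2 * n) by rewrite leq_mul2l D0 orbT.
  have : b <= b * n by rewrite leq_pmulr //; move: nL; clear; lia.
  move: Bb; set k := #|B|; rewrite (mulnCA b 2); set r := b * n.
  by clear; lia.
move=> M1 B1 c1 uc1 sc1 D1 low1 B1n.
apply: (@slow_phase n b _ b_gt0 b_small (16 * b) M1 B1 c1) => //.
- by apply: defect_zero_imp low1 _ => v /highdeg0 v_low; apply/highdeg0; move: v_low; clear; lia.
(* The slow phase costs 26b^2 * 16b = 416b^3 edges, which is at most b^2 n. *)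
- have : b * n <= b * b * n by rewrite leq_mul2r bb orbT.
  have : b * b * (416 * b) <= b * b * n.
    by rewrite leq_mul2l; apply/orP; right; move: b_small bb; clear; lia.
  rewrite [b * b * (16 * b)](mulnCA _ 16) [b * b * (416 * b)](mulnCA _ 416).
  move: B1n; set k := #|B1|; set q := b * b * b; set r := b * b * n; set r' := b * n.
  by clear; lia.
move=> M2 B2 c2 uc2 sc2 cyc0 B2n.
apply: (@all_lengths n M2 B2 c2) => //; last by move=> l l3; move: l3; clear; lia.
by move: B2n; set k := #|B2|; set r := b * b * n; clear; lia.
Qed.

End Pancyclicity.

Lemma pancyclic_sub n (M M' : {set {set 'I_n}}) :
  M \subset M' -> pancyclic M -> pancyclic M'.
Proof. by move=> sM pan l ln; apply: has_cycle_sub sM _; apply: pan. Qed.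

(* From the asymptotic hypothesis to an integer inequality *)
From mathcomp Require Import all_classical all_reals all_analysis.

Import Order.TTheory GRing.Theory Num.Theory.
Import numFieldNormedType.Exports.
Local Open Scope classical_set_scope.
Local Open Scope ring_scope.

Lemma littleo_sqrt_bound (R : realType) (b : nat -> nat) (k : nat) :
    (fun n : nat => (b n)%:R : R) =o_\oo (fun n : nat => Num.sqrt (n%:R : R)) ->
  \forall n \near \oo, (k * b n * (k * b n) <= n)%N.
Proof.
move=> /eqoP /(_ (k.+1%:R^-1)); rewrite invr_gt0 ltr0Sn => /(_ isT).
apply: filterS => n; rewrite normr_nat ger0_norm ?sqrtr_ge0 // => le.
have kb : (k * b n)%:R <= Num.sqrt (n%:R : R).
  apply: le_trans (_ : (k.+1 * b n)%:R <= _).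
    by rewrite ler_nat leq_mul2r leqnSn orbT.
  by rewrite natrM mulrC -ler_pdivlMr ?ltr0Sn // mulrC.
rewrite -(ler_nat R) natrM -[leRHS]sqr_sqrtr ?ler0n // expr2.
by apply: ler_pM.
Qed.

Theorem theorem1p7 (R : realType) (b : nat -> nat)
  (hb : (fun n : nat => (b n)%:R : R) =o_\oo (fun n : nat => Num.sqrt (n%:R : R))) :
  exists N : nat, forall n : nat, (N <= n)%N ->
    forall first : player,
      Maker_wins (edges_K n) (b n) first (@pancyclic n).
Proof.
(* The game is won even with bias b + 1, which is positive. For b > 0, (b + 1)^2 <= 4b^2 explains
   the factor 2; the summand 4 * 4000^2 covers b = 0. *)
have [N _ small] := littleo_sqrt_bound (2 * 4000) hb.
exists (N + 4 * (4000 * 4000))%N => n Nn first.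
have bn : (4000 * (4000 * ((b n).+1 * (b n).+1)) <= n)%N.
  have := small n (leq_trans (leq_addr _ _) Nn); nia.
apply: (@forces_Maker_wins _ _ (b n).+1) => //.
  by move=> M M'; apply: pancyclic_sub.
by move=> B; apply: forces_pancyclic.
Qed.
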